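(* Let $k\ge1$ be an integer, let $\lambda_1,\dots,\lambda_k>0$, put $\Lambda=\sum_{j=1}^k\lambda_j$, and let $\delta,\gamma>0$. Let $\{Y(t)\}_{t\ge0}$ be the inverse Gaussian subordinator with parameters $\delta,\gamma$, let $\{M(t)\}_{t\ge0}$ be a generalized counting process with rates $\lambda_1,\dots,\lambda_k$ independent of $Y$, and let $\mathcal Z_{f_3}(t)=M(Y(t))$. Then the probability mass function $p_{f_3}(n,t)=\mathrm{Pr}\{\mathcal Z_{f_3}(t)=n\}$ satisfies the system of differential equations $$\left(\frac{\mathrm d^2}{\mathrm dt^2}-2\delta\gamma\frac{\mathrm d}{\mathrm dt}\right)p_{f_3}(n,t)=2\delta^2\left(\Lambda p_{f_3}(n,t)-\sum_{j=1}^{\min\{n,k\}}\lambda_jp_{f_3}(n-j,t)\right),\quad n\ge0.$$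
   Context: The generalized counting process (GCP) with positive rates $\lambda_1,\dots,\lambda_k$ is the counting process $\{M(t)\}_{t\ge0}$ with $M(0)=0$ that performs $k$ kinds of jumps of amplitude $1,2,\dots,k$ with rates $\lambda_1,\dots,\lambda_k$, respectively; equivalently $M(t)=\sum_{j=1}^k jN_j(t)$ in law, where $N_1,\dots,N_k$ are independent Poisson processes with intensities $\lambda_1,\dots,\lambda_k$. The inverse Gaussian subordinator (IGS) with parameters $\delta,\gamma>0$ is the subordinator $\{Y(t)\}_{t\ge0}$ such that $Y(t)$ has density $q(x,t)=(2\pi)^{-1/2}\delta t x^{-3/2}\exp\left\{\delta\gamma t-\frac12(\delta^2t^2x^{-1}+\gamma^2x)\right\}$, $x>0$; its Bernstein function is $f_3(s)=\delta\left(\sqrt{2s+\gamma^2}-\gamma\right)$, i.e. $\mathbb E(e^{-sY(t)})=e^{-tf_3(s)}$, $s>0$. Empty sums equal $0$. *)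

(* Defs.v *)
From HB Require Import structures.
From mathcomp Require Import all_boot all_order all_algebra.
From mathcomp Require Import all_classical all_reals all_analysis.

Set Implicit Arguments.
Unset Strict Implicit.
Unset Printing Implicit Defensive.

Import Order.TTheory GRing.Theory Num.Theory.
Import numFieldNormedType.Exports.

Local Open Scope classical_set_scope.
Local Open Scope ring_scope.

(* A real-valued stochastic process is a function X : R -> T -> R, of which
   only the times t >= 0 are relevant. *)

Section Processes.
Context (R : realType) (d : measure_display) (T : measurableType d).
Variable P : probability T R.

Definition prob (A : set T) : R := fine (P A).

Definition independent_increments (X : R -> T -> R) : Prop :=
  forall (m : nat) (s : nat -> R) (B : nat -> set R),
    0 <= s 0%N -> (forall i, s i <= s i.+1) -> (forall i, measurable (B i)) ->
    prob [set w | forall i, (i < m)%N -> B i (X (s i.+1) w - X (s i) w)] =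
    \prod_(i < m) prob [set w | B i (X (s i.+1) w - X (s i) w)].

Definition stationary_increments (X : R -> T -> R) : Prop :=
  forall (s h : R) (B : set R), 0 <= s -> 0 <= h -> measurable B ->
    prob [set w | B (X (s + h) w - X s w)] =
    prob [set w | B (X h w - X 0 w)].

(* Left limits of the paths exist by monotonicity, and stochastic continuity
   follows from right-continuity and stationarity: this is a Levy process with
   nondecreasing paths. *)
Record subordinator (X : R -> T -> R) : Prop := Subordinator {
  subordinator_measurable : forall t, 0 <= t -> measurable_fun setT (X t) ;
  subordinator_start : forall w, X 0 w = 0 ;
  subordinator_independent : independent_increments X ;
  subordinator_stationary : stationary_increments X ;
  subordinator_nondecreasing :
    forall w s t, 0 <= s -> s <= t -> X s w <= X t w ;
  subordinator_right_continuous :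
    forall w t, 0 <= t -> X s w @[s --> t^'+] --> X t w }.

Definition sigma_process (X : R -> T -> R) : set (set T) :=
  <<s [set A | exists t (B : set R),
         [/\ 0 <= t, measurable B & A = X t @^-1` B]] >>.

Definition independent_processes (X Y : R -> T -> R) : Prop :=
  forall A B : set T, sigma_process X A -> sigma_process Y B ->
    prob (A `&` B) = prob A * prob B.

(* The rates are lam 1, ..., lam k; the other values of lam are irrelevant.
   A counting process started at 0 with independent and stationary increments
   is a subordinator with values in nat; the last three fields say that it
   jumps by j at rate lam j for 1 <= j <= k, and in no other way. *)
Record generalized_counting_process (k : nat) (lam : nat -> R)
    (M : R -> T -> nat) : Prop := GeneralizedCountingProcess {
  gcp_subordinator : subordinator (fun t w => (M t w)%:R) ;
  gcp_no_jump :
    (fun h => prob [set w | M h w = 0%N]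
              - (1 - (\sum_(1 <= j < k.+1) lam j) * h))
      =o_ ((0 : R)^'+) id ;
  gcp_jump : forall j : nat, (1 <= j <= k)%N ->
    (fun h => prob [set w | M h w = j] - lam j * h) =o_ ((0 : R)^'+) id ;
  gcp_large_jump :
    (fun h => prob [set w | (k < M h w)%N]) =o_ ((0 : R)^'+) id }.

Definition ig_density (delta gamma x t : R) : R :=
  (2 * pi) `^ (- (1 / 2)) * delta * t * x `^ (- (3 / 2)) *
  expR (delta * gamma * t
        - 1 / 2 * (delta ^+ 2 * t ^+ 2 * x^-1 + gamma ^+ 2 * x)).

Record inverse_gaussian_subordinator (delta gamma : R)
    (Y : R -> T -> R) : Prop := InverseGaussianSubordinator {
  igs_subordinator : subordinator Y ;
  igs_density : forall (t : R) (B : set R), 0 < t -> measurable B ->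
    P (Y t @^-1` B) =
    (\int[lebesgue_measure]_(x in B `&` [set x | (0 < x)%R])
       (ig_density delta gamma x t)%:E)%E }.

Definition time_changed_pmf (M : R -> T -> nat) (Y : R -> T -> R)
    (n : nat) (t : R) : R :=
  prob [set w | M (Y t w) w = n].

End Processes.

(* Main.v *)
Require Import Defs.
From HB Require Import structures.
From mathcomp Require Import all_boot all_order all_algebra.
From mathcomp Require Import all_classical all_reals all_analysis.
From mathcomp Require Import measurable_realfun.
From mathcomp Require Import ring lra.

(** Let [q x t] be the density of [Y t] and [u n x] the probability that
    [M x = n].

    Conditioning on the value of [Y t], which is independent of [M], gives
    [p n t = \int_(0, +oo) u n x * q x t dx] ([time_changed_prob]).  Two facts are
    then combined.

    - The density solves the parabolic equation
      [q_tt - 2 * delta * gamma * q_t = 2 * delta ^+ 2 * q_x]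
      ([ig_density_pde]), a direct computation from its explicit form.
    - The counting process has stationary independent increments, so [u] is a
      convolution semigroup of sequences, and the infinitesimal jump
      probabilities determine its derivative: the forward equation
      [u_n' = - Lambda * u n + \sum_j lam j * u (n - j)]
      ([is_derive_count_pmf], [jump_rate_sum]).

    Differentiating twice under the integral sign
    ([is_derive_weighted_integral]), the operator in [t] on the left-hand side
    becomes [2 * delta ^+ 2] times the integral of [u n x * q_x x t].  Integrating
    by parts ([ig_density_by_parts]) turns this into [- 2 * delta ^+ 2] times the
    integral of [u_n' x * q x t], and the forward equation yields the right-hand
    side.

    The analysis rests on one estimate ([ig_core_bound]): locally uniformly in
    [t > 0], the density and its partial derivatives are bounded by a constant
    times [expR (- (gamma ^+ 2 / 2) * x)], because the factor
    [expR (- delta ^+ 2 * t ^+ 2 / (2 * x))] absorbs every power of [x^-1].  It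
    gives the domination needed for differentiating under the integral and the
    vanishing of the boundary terms. *)

Set Implicit Arguments.
Unset Strict Implicit.
Unset Printing Implicit Defensive.

Import Order.TTheory GRing.Theory Num.Theory.
Import numFieldNormedType.Exports.

Local Open Scope classical_set_scope.
Local Open Scope ring_scope.

(** * Differentiability of convolution semigroups *)

Lemma cvg_sumr (R : realType) (T I : Type) (F : set_system T) {FF : Filter F}
    (r : seq I) (f : I -> T -> R) (l : I -> R) :
  (forall i, f i x @[x --> F] --> l i) ->
  \sum_(i <- r) f i x @[x --> F] --> \sum_(i <- r) l i.
Proof.
by move=> fl; apply: cvg_big => [|i _]; [exact: add_continuous|exact: fl].
Qed.

Section ConvolutionSemigroup.
Context {R : realType}.
Variables (u : nat -> R -> R) (a : nat -> R).
Hypothesis u_bnd : forall (n : nat) (x : R), 0 <= x -> `|u n x| <= 1.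
Hypothesis uD : forall (n : nat) (x h : R), 0 <= x -> 0 <= h ->
  u n (x + h) = \sum_(i < n.+1) u (n - i)%N x * u i h.
Hypothesis u_rate : forall i,
  h^-1 * (u i h - (i == 0%N)%:R) @[h --> (0 : R)^'+] --> a i.

Let uB (n : nat) (x h : R) : 0 <= x -> 0 <= h ->
  u n (x + h) - u n x = \sum_(i < n.+1) u (n - i)%N x * (u i h - (i == 0%N :> nat)%:R).
Proof.
move=> x0 h0; rewrite uD//.
under [in RHS]eq_bigr do rewrite mulrBr.
rewrite sumrB; congr (_ - _).
rewrite big_ord_recl/= subn0 mulr1 big1 ?addr0// => i _.
by rewrite mulr0.
Qed.

Let u_right0 i : u i h - (i == 0%N)%:R @[h --> (0 : R)^'+] --> 0.
Proof.
have H : h * (h^-1 * (u i h - (i == 0%N)%:R)) @[h --> (0 : R)^'+] --> 0 * a i.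
  apply: cvgM; last exact: u_rate.
  exact: cvg_at_right_filter.
rewrite mul0r in H; apply: cvg_trans H.
apply: near_eq_cvg; near=> h.
by rewrite mulrA divff ?mul1r// gt_eqF.
Unshelve. all: by end_near. Qed.

(** An increment of [u n] is bounded by the increments at [0] alone, because the
    other factors of the convolution are bounded by [1]. *)
Let u_left_continuous (n : nat) (x : R) : 0 < x -> u n (x - h) @[h --> (0 : R)^'+] --> u n x.
Proof.
move=> x0; apply/cvgrPdist_le => e e0.
have S0 : \sum_(i < n.+1) `|u i h - (i == 0%N :> nat)%:R| @[h --> (0 : R)^'+] --> 0.
  rewrite [X in _ --> X](_ : _ = \sum_(i < n.+1) (0 : R)); last by rewrite big1.
  apply: cvg_sumr => i.
  by rewrite -[X in _ --> X](@normr0 _ R); apply: cvg_norm; exact: u_right0.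
have /cvgrPdist_le/(_ _ e0) := S0.
move=> S0e; near=> h.
have h0 : 0 < h by [].
have hx : h <= x by near: h; exact: nbhs_right_le.
rewrite -[in u n x](subrK h x) uB ?subr_ge0 ?(ltW h0)//.
apply: (@le_trans _ _ (\sum_(i < n.+1) `|u i h - (i == 0%N :> nat)%:R|)).
  apply: le_trans (ler_norm_sum _ _ _) _.
  apply: ler_sum => i _; rewrite normrM ler_piMl//.
  by apply: u_bnd; rewrite subr_ge0.
have : `|0 - \sum_(i < n.+1) `|u i h - (i == 0%N :> nat)%:R| | <= e by near: h.
by rewrite sub0r normrN; apply: le_trans; exact: ler_norm.
Unshelve. all: by end_near. Qed.

(** The right difference quotient at [x] is a finite combination of the rates at
    [0], by the semigroup law between [x] and [x + h].  The left one comes from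
    the same law between [x - h] and [x], whose coefficients [u _ (x - h)] move
    with [h]: this is why left continuity has to be known beforehand. *)
Lemma convolution_semigroup_is_derive (n : nat) (x : R) : 0 < x ->
  is_derive x 1 (u n) (\sum_(i < n.+1) a i * u (n - i)%N x).
Proof.
move=> x0.
suff H : h^-1 * (u n (h + x) - u n x) @[h --> (0 : R)^'] -->
    \sum_(i < n.+1) a i * u (n - i)%N x.
  have D : derivable (u n) x 1.
    apply/cvg_ex; eexists.
    under eq_fun do rewrite /= scaler1.
    exact: H.
  apply: DeriveDef => //; rewrite -derive1E; apply/cvg_lim => //.
apply: (@cvg_at_right_left_dnbhs _ R^o).
- apply: (@cvg_trans _ (\sum_(i < n.+1)
    (h^-1 * (u i h - (i == 0%N :> nat)%:R)) * u (n - i)%N x @[h --> (0 : R)^'+])).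
    apply: near_eq_cvg; near=> h.
    rewrite (addrC h x) uB ?(ltW x0)// mulr_sumr; apply: eq_bigr => i _.
    by rewrite mulrCA mulrC.
  apply: cvg_sumr => i; apply: cvgM; last exact: cvg_cst.
  exact: u_rate.
- apply/cvg_at_leftNP; rewrite oppr0.
  apply: (@cvg_trans _ (\sum_(i < n.+1)
    (h^-1 * (u i h - (i == 0%N :> nat)%:R)) * u (n - i)%N (x - h) @[h --> (0 : R)^'+])).
    apply: near_eq_cvg; near=> h => /=.
    have h0 : 0 < h by [].
    have hx : h <= x by near: h; exact: nbhs_right_le.
    rewrite (addrC (- h) x) -[in u n x](subrK h x) invrN mulNr -mulrN opprB.
    rewrite uB ?subr_ge0 ?(ltW h0)// mulr_sumr; apply: eq_bigr => i _.
    by rewrite mulrCA mulrC.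
  apply: cvg_sumr => i; apply: cvgM; first exact: u_rate.
  exact: u_left_continuous.
Unshelve. all: by end_near. Qed.

End ConvolutionSemigroup.

(** * The forward equation of the counting process *)

Section Prob.
Context (R : realType) (d : measure_display) (T : measurableType d).
Variable P : probability T R.

Lemma probE A : measurable A -> (prob P A)%:E = P A.
Proof. by move=> mA; rewrite /prob fineK// fin_num_measure. Qed.

Lemma prob_ge0 A : 0 <= prob P A.
Proof. exact: fine_ge0. Qed.

Lemma prob_le1 A : measurable A -> prob P A <= 1.
Proof. by move=> mA; rewrite -lee_fin probE// probability_le1. Qed.

Lemma le_prob A B : measurable A -> measurable B -> A `<=` B ->
  prob P A <= prob P B.
Proof. by move=> mA mB AB; rewrite -lee_fin !probE// le_measure// inE. Qed.

Lemma prob_bigcup_ord (n : nat) (F : nat -> set T) :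
  (forall i, measurable (F i)) -> trivIset setT F ->
  prob P (\bigcup_(i < n) F i) = \sum_(i < n) prob P (F i).
Proof.
move=> mF tF; apply: EFin_inj; rewrite probE; last first.
  by apply: fin_bigcup_measurable => // i _.
rewrite bigcup_mkord measure_bigsetU// -sumEFin.
by apply: eq_bigr => i _; rewrite probE.
Qed.

End Prob.

Section CountingProcess.
Context (R : realType) (d : measure_display) (T : measurableType d).
Variables (P : probability T R) (k : nat) (lam : nat -> R) (M : R -> T -> nat).
Hypothesis gcpM : generalized_counting_process P k lam M.

Let subM := gcp_subordinator gcpM.

Lemma measurable_count (x : R) (A : set R) : 0 <= x -> measurable A ->
  measurable [set w | A (M x w)%:R].
Proof.
move=> x0 mA; rewrite -[X in measurable X]setTI.
exact: (subordinator_measurable subM x0).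
Qed.

Lemma measurable_count_eq (x : R) (n : nat) : 0 <= x ->
  measurable [set w | M x w = n].
Proof.
move=> x0; rewrite (_ : [set w | _] = [set w | [set n%:R : R] (M x w)%:R]).
  exact: measurable_count.
by apply/seteqP; split => w /= => [->//|/eqP]; rewrite eqr_nat => /eqP.
Qed.

Definition count_pmf (n : nat) (x : R) : R := prob P [set w | M x w = n].

Let start w : M 0 w = 0%N.
Proof. by have /eqP := subordinator_start subM w; rewrite pnatr_eq0 => /eqP. Qed.

(** The value at time [x + h] is [n] exactly when, for some [i <= n], the value at
    [x] is [n - i] and the increment over [[x, x + h]] is [i]; no other
    decomposition occurs since paths are nondecreasing.  Independence and
    stationarity of the increments then factor each of these events. *)
Lemma count_pmfD (n : nat) (x h : R) : 0 <= x -> 0 <= h ->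
  count_pmf n (x + h) = \sum_(i < n.+1) count_pmf (n - i) x * count_pmf i h.
Proof.
move=> x0 h0.
have xh0 : 0 <= x + h by exact: addr_ge0.
pose inc (i : nat) : set T := [set w | (M (x + h) w)%:R - (M x w)%:R = i%:R :> R].
have incE w i : inc i w <-> M (x + h) w = (M x w + i)%N.
  rewrite /inc/=; split=> [/eqP|->]; last by rewrite natrD addrAC subrr add0r.
  by rewrite subr_eq -natrD eqr_nat addnC => /eqP.
pose E (i : nat) : set T := [set w | M x w = (n - i)%N] `&` inc i.
have minc i : measurable (inc i).
  have := measurable_funB (subordinator_measurable subM xh0)
    (subordinator_measurable subM x0).
  by move=> /(_ measurableT [set i%:R] (measurable_set1 _)); rewrite setTI.
have mE i : measurable (E i) by apply: measurableI => //; exact: measurable_count_eq.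
have tE : trivIset setT E.
  apply/trivIsetP => i j _ _ ij; apply/seteqP; split => // w [[_ /incE Ei] [_ /incE Ej]].
  by move: ij; rewrite -(eqn_add2l (M x w)) -Ei -Ej eqxx.
have -> : count_pmf n (x + h) = prob P (\bigcup_(i < n.+1) E i).
  congr (prob P _); apply/seteqP; split => w /=.
  - move=> Mn; have /= := subordinator_nondecreasing subM w x0 (ler_wpDr h0 (lexx x)).
    rewrite ler_nat Mn => le.
    exists (n - M x w)%N => /=; first by rewrite ltnS leq_subr.
    by split; [rewrite /= subKn|apply/incE; rewrite subnKC].
  - by move=> [i /= i_n] [/= Mx /incE ->]; rewrite Mx subnK.
rewrite prob_bigcup_ord//; apply: eq_bigr => i _.
(* The subdivision 0 <= x <= x + h, constant afterwards; the first increment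
   is the value at x because the process starts at 0. *)
pose s (j : nat) : R := if j is j'.+1 then (if j' is 0%N then x else x + h) else 0.
pose B (j : nat) : set R := if j is 0%N then [set (n - i)%:R] else [set i%:R].
have := @subordinator_independent _ _ _ _ _ subM 2 s B.
have s_mono j : s j <= s j.+1.
  by case: j => [|[|j]] //=; rewrite lerDl.
have mB j : measurable (B j) by case: j => [|j]; exact: measurable_set1.
move=> /(_ (lexx _) s_mono mB).
rewrite big_ord_recl big_ord1/=.
have -> : [set w | forall j, (j < 2)%N -> B j ((M (s j.+1) w)%:R - (M (s j) w)%:R)] = E i.
  apply/seteqP; split => w /=.
  - move=> H; split.
    + have /= := H 0%N isT; rewrite start subr0 => /eqP.
      by rewrite eqr_nat => /eqP.
    + exact: (H 1%N isT).
  - move=> [Mx Ei] [_|[_|//]] //=.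
    by rewrite start subr0 Mx.
move=> ->; congr (_ * _).
- congr (prob P _); apply/seteqP; split => w /=; rewrite start subr0.
    by move=> /eqP; rewrite eqr_nat => /eqP.
  by move=> ->.
- have := @subordinator_stationary _ _ _ _ _ subM x h [set i%:R] x0 h0 (measurable_set1 _).
  rewrite /= => ->.
  congr (prob P _); apply/seteqP; split => w /=; rewrite start subr0.
    by move=> /eqP; rewrite eqr_nat => /eqP.
  by move=> ->.
Qed.

Lemma count_pmf_ge0 n x : 0 <= count_pmf n x.
Proof. exact: prob_ge0. Qed.

Lemma count_pmf_norm_le1 (n : nat) (x : R) : 0 <= x -> `|count_pmf n x| <= 1.
Proof.
move=> x0; rewrite ger0_norm ?count_pmf_ge0//.
by apply: prob_le1; exact: measurable_count_eq.
Qed.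

(** The generator of the process, which acts on sequences by convolution with
    these coefficients; hence the negative value at [0]. *)
Definition jump_rate (i : nat) : R :=
  if i is 0%N then - \sum_(1 <= j < k.+1) lam j
  else if (i <= k)%N then lam i else 0.

(** The error term is only required to dominate, so that the same statement
    serves for the jumps of size above [k], which are known through their union. *)
Let littleo_quotient (f : R -> R) (r : R) (g : R -> R) :
  f =o_ ((0 : R)^'+) id ->
  (\forall h \near (0 : R)^'+, `|g h - r * h| <= `|f h|) ->
  h^-1 * g h @[h --> (0 : R)^'+] --> r.
Proof.
move=> /eqoP fo gf; apply/cvgrPdist_le => e e0.
have {}fo := fo _ e0; near=> h.
have h0 : 0 < h by [].
have -> : r - h^-1 * g h = - (h^-1 * (g h - r * h)).
  by field; rewrite gt_eqF.
rewrite normrN normrM gtr0_norm ?invr_gt0// mulrC ler_pdivrMr//.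
have : `|f h| <= e * `|h| by near: h.
rewrite (gtr0_norm h0); apply: le_trans.
by near: h.
Unshelve. all: by end_near. Qed.

Lemma count_pmf_rate (i : nat) :
  h^-1 * (count_pmf i h - (i == 0%N)%:R) @[h --> (0 : R)^'+] --> jump_rate i.
Proof.
case: i => [|i].
  apply: (littleo_quotient (gcp_no_jump gcpM)); apply: nearW => h /=.
  by rewrite le_eqVlt; apply/orP; left; apply/eqP; congr (`| _ |); rewrite /count_pmf; ring.
rewrite /=; under eq_fun do rewrite subr0.
case: ifPn => ik.
  have ik' : (1 <= i.+1 <= k)%N by [].
  by apply: (littleo_quotient (gcp_jump gcpM ik')); exact: nearW.
apply: (littleo_quotient (gcp_large_jump gcpM)); near=> h.
have h0 : 0 <= h by apply: ltW.
rewrite mul0r subr0 !ger0_norm ?prob_ge0//.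
apply: le_prob; first exact: measurable_count_eq.
- rewrite (_ : [set w | _] = [set w | [set` `]k%:R, +oo[] ((M h w)%:R : R)]).
    by apply: measurable_count => //; exact: measurable_itv.
  by apply/seteqP; split => w /=; rewrite in_itv/= andbT ltr_nat.
- by move=> w /= ->; rewrite ltnNge.
Unshelve. all: by end_near. Qed.

Lemma is_derive_count_pmf (n : nat) (x : R) : 0 < x ->
  is_derive x 1 (count_pmf n) (\sum_(i < n.+1) jump_rate i * count_pmf (n - i) x).
Proof.
apply: convolution_semigroup_is_derive.
- by move=> m y; exact: count_pmf_norm_le1.
- exact: count_pmfD.
- exact: count_pmf_rate.
Qed.

(** Convolution with the generator, in the form of the right-hand side of
    Kolmogorov's forward equation: indices above [k] carry no rate and indices
    above [n] do not occur. *)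
Lemma jump_rate_sum (n : nat) (f : nat -> R) :
  \sum_(i < n.+1) jump_rate i * f (n - i)%N =
  - ((\sum_(1 <= j < k.+1) lam j) * f n -
     \sum_(1 <= j < (minn n k).+1) lam j * f (n - j)%N).
Proof.
rewrite big_ord_recl/= subn0 opprB mulNr addrC; congr (_ - _).
rewrite [RHS]big_add1/= big_mkord.
under eq_bigr => i _ do rewrite /bump leq0n add1n.
rewrite -(big_mkord xpredT (fun i => (if (i < k)%N then lam i.+1 else 0) * f (n - i.+1)%N)).
rewrite -(big_mkord xpredT (fun i => lam i.+1 * f (n - i.+1)%N)).
rewrite (@big_cat_nat _ _ _ (minn n k)) ?geq_minl//=.
rewrite [X in _ + X]big_nat_cond [X in _ + X]big1 ?addr0; last first.
  move=> i /andP[/andP[+ i_n] _]; rewrite geq_min => /orP[|ki].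
    by rewrite leqNgt i_n.
  by rewrite ltnNge ki mul0r.
rewrite !big_nat; apply: eq_bigr => i /andP[_].
by rewrite leq_min => /andP[_ ->].
Qed.

End CountingProcess.

(** * The inverse Gaussian density and its partial derivatives *)

Section InverseGaussianDensity.
Context {R : realType}.
Variables (delta gamma : R).
Hypotheses (delta_gt0 : 0 < delta) (gamma_gt0 : 0 < gamma).

(** The density divided by [t].  Each partial derivative of the density is this
    factor times a polynomial in [t] and [x^-1], so it alone carries the
    estimates. *)
Definition ig_core (x t : R) : R :=
  (2 * pi) `^ (- (1 / 2)) * delta * x `^ (- (3 / 2)) *
  expR (delta * gamma * t
        - 1 / 2 * (delta ^+ 2 * t ^+ 2 * x^-1 + gamma ^+ 2 * x)).

Definition ig_density_dt (x t : R) : R :=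
  ig_core x t * (1 + delta * gamma * t - delta ^+ 2 * t ^+ 2 * x^-1).

Definition ig_density_dtt (x t : R) : R :=
  ig_core x t *
  ((delta * gamma - delta ^+ 2 * t * x^-1) *
   (1 + delta * gamma * t - delta ^+ 2 * t ^+ 2 * x^-1) +
   (delta * gamma - 2 * delta ^+ 2 * t * x^-1)).

Definition ig_density_dx (x t : R) : R :=
  ig_core x t * t *
  (delta ^+ 2 * t ^+ 2 * x^-1 ^+ 2 / 2 - 3 / 2 * x^-1 - gamma ^+ 2 / 2).

Lemma ig_densityE (x t : R) : ig_density delta gamma x t = ig_core x t * t.
Proof. by rewrite /ig_density /ig_core; ring. Qed.

Lemma ig_core_ge0 (x t : R) : 0 <= ig_core x t.
Proof.
by rewrite /ig_core !mulr_ge0// ?powR_ge0 ?expR_ge0// ltW.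
Qed.

(** After division by [ig_core], both sides are the same polynomial in [t] and
    [x^-1]. *)
Lemma ig_density_pde (x t : R) : 0 < x ->
  ig_density_dtt x t - 2 * delta * gamma * ig_density_dt x t =
  2 * delta ^+ 2 * ig_density_dx x t.
Proof.
by move=> x0; rewrite /ig_density_dtt /ig_density_dt /ig_density_dx; field; rewrite gt_eqF.
Qed.

Let is_derive_mul (f g : R -> R) (x a b : R) :
  is_derive x 1 f a -> is_derive x 1 g b ->
  is_derive x 1 (fun y => f y * g y) (f x * b + a * g x).
Proof.
move=> fa gb; by apply: (is_derive_eq (is_deriveM fa gb)); rewrite /GRing.scale/=; ring.
Qed.

Let is_derive_expRf (f : R -> R) (x a : R) : is_derive x 1 f a ->
  is_derive x 1 (fun y => expR (f y)) (expR (f x) * a).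
Proof. by move=> fa; exact: (is_derive1_comp (is_derive_expR (f x)) fa). Qed.

Lemma is_derive_ig_core_t (x t : R) :
  is_derive t 1 (ig_core x) (ig_core x t * (delta * gamma - delta ^+ 2 * t * x^-1)).
Proof.
have H : is_derive t 1 (fun t : R => delta * gamma * t
        - 1 / 2 * (delta ^+ 2 * t ^+ 2 * x^-1 + gamma ^+ 2 * x))
  (delta * gamma - delta ^+ 2 * t * x^-1).
  rewrite [X in is_derive _ _ X](_ : _ = ((delta * gamma) *: (@id R)
     - (1 / 2 * delta ^+ 2 * x^-1) *: ((@id R) ^+ 2) - cst (1 / 2 * gamma ^+ 2 * x))).
    by apply: is_derive_eq; rewrite /GRing.scale/=; move: x^-1 => v; field.
  by apply/funext => y; rewrite !fctE /GRing.scale/=; ring.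
apply: (is_derive_eq (is_derive_mul
 (is_derive_cst ((2 * pi) `^ (- (1 / 2)) * delta * x `^ (- (3 / 2))) t 1)
 (is_derive_expRf H))).
by rewrite /ig_core/=; ring.
Qed.

Lemma is_derive_ig_density_t (x t : R) :
  is_derive t 1 (ig_density delta gamma x) (ig_density_dt x t).
Proof.
rewrite (_ : ig_density delta gamma x = (fun t => ig_core x t * t)); last first.
  by apply/funext => s; exact: ig_densityE.
apply: (is_derive_eq (is_derive_mul (is_derive_ig_core_t x t) (is_derive_id t 1))).
by rewrite /ig_density_dt/=; ring.
Qed.

Lemma is_derive_ig_density_dt (x t : R) :
  is_derive t 1 (ig_density_dt x) (ig_density_dtt x t).
Proof.
have H : is_derive t 1 (fun t : R => 1 + delta * gamma * t - delta ^+ 2 * t ^+ 2 * x^-1)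
  (delta * gamma - 2 * delta ^+ 2 * t * x^-1).
  rewrite [X in is_derive _ _ X](_ : _ = (cst 1 + (delta * gamma) *: (@id R)
     - (delta ^+ 2 * x^-1) *: ((@id R) ^+ 2))).
    apply: is_derive_eq.
    by rewrite /GRing.scale/=; ring.
  by apply/funext => y; rewrite !fctE /GRing.scale/=; ring.
apply: (is_derive_eq (is_derive_mul (is_derive_ig_core_t x t) H)).
by rewrite /ig_density_dtt; ring.
Qed.

Lemma is_derive_ig_density_x (x t : R) : 0 < x ->
  is_derive x 1 (fun x => ig_density delta gamma x t) (ig_density_dx x t).
Proof.
move=> x0.
have H : is_derive x 1 (fun x : R => delta * gamma * t
        - 1 / 2 * (delta ^+ 2 * t ^+ 2 * x^-1 + gamma ^+ 2 * x))
  (delta ^+ 2 * t ^+ 2 * x^-1 ^+ 2 / 2 - gamma ^+ 2 / 2).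
  have dV : is_derive x 1 (fun y : R => y^-1) (- x ^- 2).
    have xn0 : (@id R) x != 0 by rewrite gt_eqF.
    have did : derivable (@id R) x 1 by exact: derivable_id.
    apply: DeriveDef; first exact: derivableV xn0 did.
    by rewrite (deriveV xn0 did) derive_id /GRing.scale/= mulr1.
  rewrite [X in is_derive _ _ X](_ : _ = (cst (delta * gamma * t)
     - (1 / 2 * delta ^+ 2 * t ^+ 2) *: (fun y : R => y^-1) - (1 / 2 * gamma ^+ 2) *: (@id R))).
    apply: (is_derive_eq (is_deriveB (is_deriveB (is_derive_cst _ x 1) (is_deriveZ _ dV))
      (is_deriveZ _ (is_derive_id x 1)))).
    by rewrite /GRing.scale/=; field; rewrite gt_eqF.
  by apply/funext => y; rewrite !fctE /GRing.scale/=; ring.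
apply: (is_derive_eq (is_derive_mul (is_derive_mul
  (is_derive_cst ((2 * pi) `^ (- (1 / 2)) * delta * t) x 1)
  (is_derive1_powR (- (3 / 2)) x0)) (is_derive_expRf H))).
have -> : x `^ (- (3 / 2) - 1) = x `^ (- (3 / 2)) * x^-1.
  by rewrite powRD ?powR_inv1 ?(ltW x0)// (gt_eqF x0) implybT.
by rewrite /ig_density_dx /ig_core/=; field; rewrite gt_eqF.
Qed.

(** The only danger is the pole at [x = 0].  With [u := x^-1], the factor
    [x `^ (- (3 / 2))] is at most [(1 + u) ^+ 2], and [(1 + u) ^+ 5] is absorbed by
    [expR (- (c * u))], where [c := delta ^+ 2 * a ^+ 2 / 2] bounds from below the
    coefficient of [u] in the exponent for all times at least [a].  What is left
    is the decay in [x]; the cube leaves room for the polynomial factors of the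
    partial derivatives. *)
Lemma ig_core_bound (a b : R) : 0 < a -> exists2 C : R, 0 <= C &
  forall x t : R, 0 < x -> a <= t <= b ->
    ig_core x t * (1 + x^-1) ^+ 3 <= C * expR (- (gamma ^+ 2 / 2) * x).
Proof.
move=> a0.
pose c := delta ^+ 2 * a ^+ 2 / 2.
have c0 : 0 < c by rewrite /c !mulr_gt0// ?exprn_gt0.
pose K := (2 * pi) `^ (- (1 / 2)) * delta : R.
have K0 : 0 <= K by rewrite mulr_ge0 ?powR_ge0// ltW.
exists (K * expR (delta * gamma * b) * ((c / 5)^-1 ^+ 5 * expR c)).
  rewrite mulr_ge0 ?(mulr_ge0 K0) ?expR_ge0//.
  by rewrite mulr_ge0 ?expR_ge0 ?exprn_ge0// invr_ge0 divr_ge0// ltW.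
move=> x t x0 /andP[at_ tb].
have u0 : 0 < x^-1 by rewrite invr_gt0.
set u := x^-1 in u0 *.
have xu : x `^ (- (3 / 2)) <= (1 + u) ^+ 2.
  rewrite /powR gt_eqF//.
  have -> : (1 + u) ^+ 2 = expR (2 * ln (1 + u)).
    by rewrite expRM_natl lnK// posrE addr_gt0.
  rewrite ler_expR.
  have l0 : 0 <= ln (1 + u) by rewrite ln_ge0// lerDl ltW.
  (* 3 / 2 * ln u <= 2 * ln (1 + u), whatever the sign of ln u *)
  have lx : - ln x <= ln (1 + u).
    by rewrite -lnV ?posrE// ler_ln ?posrE ?addr_gt0// lerDr.
  by lra.
have eu : expR (delta * gamma * t - 1 / 2 * (delta ^+ 2 * t ^+ 2 * u + gamma ^+ 2 * x)) <=
   expR (delta * gamma * b) * expR (- (c * u)) * expR (- (gamma ^+ 2 / 2) * x).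
  rewrite -!expRD ler_expR.
  have H1 : delta * gamma * t <= delta * gamma * b by rewrite ler_pM2l ?mulr_gt0.
  have H2 : c * u <= delta ^+ 2 * t ^+ 2 / 2 * u.
    rewrite ler_pM2r// /c ler_pM2r ?invr_gt0// ler_pM2l ?exprn_gt0//.
    by rewrite lerXn2r// nnegrE ltW// (lt_le_trans a0).
  by lra.
have c50 : 0 < c / 5 by exact: divr_gt0.
(* y <= expR y at y = (1 + u) * (c / 5), raised to the fifth power. *)
have pu : (1 + u) ^+ 5 * expR (- (c * u)) <= (c / 5)^-1 ^+ 5 * expR c.
  have -> : expR (- (c * u)) = expR c * (expR (c * (1 + u)))^-1.
    by rewrite -expRN -expRD; congr expR; ring.
  rewrite mulrCA [leRHS]mulrC ler_pM2l ?expR_gt0//.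
  rewrite ler_pdivrMr ?expR_gt0// exprVn mulrC ler_pdivlMr ?exprn_gt0//.
  rewrite -exprMn (_ : c * (1 + u) = 5 * ((1 + u) * (c / 5))); last by field.
  have le1 : (1 + u) * (c / 5) <= expR ((1 + u) * (c / 5)).
    by apply: le_trans (expR_ge1Dx _); rewrite lerDr.
  have ge0 : 0 <= (1 + u) * (c / 5).
    apply: mulr_ge0; first by rewrite addr_ge0// ltW.
    exact: ltW.
  by rewrite expRM_natl lerXn2r// ?nnegrE ?expR_ge0.
set e1 := expR (delta * gamma * b) in eu *; set e2 := expR (- (c * u)) in eu pu.
set e3 := expR (- (gamma ^+ 2 / 2) * x) in eu *.
rewrite /ig_core -/u [leLHS](_ : _ = K * (x `^ (- (3 / 2)) *
  expR (delta * gamma * t - 1 / 2 * (delta ^+ 2 * t ^+ 2 * u + gamma ^+ 2 * x)) *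
  (1 + u) ^+ 3)); last by rewrite /K; ring.
rewrite [leRHS](_ : _ = K * ((c / 5)^-1 ^+ 5 * expR c * (e1 * e3))); last by ring.
apply: ler_wpM2l => //.
apply: (@le_trans _ _ ((1 + u) ^+ 2 * (e1 * e2 * e3) * (1 + u) ^+ 3)).
  apply: ler_wpM2r; first by rewrite exprn_ge0// addr_ge0// ltW.
  by apply: ler_pM => //; rewrite ?powR_ge0 ?expR_ge0.
rewrite [leLHS](_ : _ = (1 + u) ^+ 5 * e2 * (e1 * e3)); last by ring.
by apply: ler_wpM2r => //; rewrite mulr_ge0 ?expR_ge0.
Qed.

End InverseGaussianDensity.

Section Domination.
Context {R : realType}.
Variables (delta gamma a b : R).
Hypotheses (delta_gt0 : 0 < delta) (gamma_gt0 : 0 < gamma) (a_gt0 : 0 < a).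

(** Growth of a polynomial in [t] and [x^-1] as [x] tends to [0], uniformly for
    times in [[a, b]]. *)
Let pole_order (n : nat) (f : R -> R -> R) := exists2 K : R, 0 <= K &
  forall x t : R, 0 < x -> a <= t <= b -> `|f x t| <= K * (1 + x^-1) ^+ n.

Let pole_cst (k : R) : pole_order 0 (fun _ _ => k).
Proof. by exists `|k| => // x t _ _; rewrite expr0 mulr1. Qed.

Let pole_time : pole_order 0 (fun _ t => t).
Proof.
exists `|b| => // x t _ /andP[at_ tb].
rewrite expr0 mulr1 ger0_norm ?(le_trans tb) ?ler_norm//.
exact: le_trans (ltW a_gt0) at_.
Qed.

Let pole_inv : pole_order 1 (fun x _ => x^-1).
Proof.
exists 1 => // x t x0 _; rewrite expr1 mul1r gtr0_norm ?invr_gt0// lerDr.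
exact: ler01.
Qed.

Let pole_ge1 (x : R) n : 0 < x -> 1 <= (1 + x^-1) ^+ n.
Proof. by move=> x0; rewrite exprn_ege1// lerDl invr_ge0 ltW. Qed.

Let poleD m n f g : pole_order m f -> pole_order n g ->
  pole_order (m + n) (fun x t => f x t + g x t).
Proof.
move=> [K K0 fK] [L L0 gL]; exists (K + L) => [|x t x0 tab]; first exact: addr_ge0.
apply: le_trans (ler_normD _ _) _; rewrite mulrDl exprD; apply: lerD.
- apply: le_trans (fK _ _ x0 tab) _.
  by rewrite mulrA ler_peMr ?pole_ge1// mulr_ge0// (le_trans ler01)// pole_ge1.
- apply: le_trans (gL _ _ x0 tab) _.
  by rewrite (mulrC (_ ^+ m)) mulrA ler_peMr ?pole_ge1// mulr_ge0// (le_trans ler01)// pole_ge1.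
Qed.

Let poleM m n f g : pole_order m f -> pole_order n g ->
  pole_order (m + n) (fun x t => f x t * g x t).
Proof.
move=> [K K0 fK] [L L0 gL]; exists (K * L) => [|x t x0 tab]; first exact: mulr_ge0.
by rewrite normrM exprD mulrACA ler_pM ?fK ?gL.
Qed.

(** Differentiation under the integral sign needs one integrable bound for all
    times of a window, whence the constant chosen before [t]. *)
Definition exp_dominated (g : R -> R -> R) := exists2 C : R, 0 <= C &
  forall x t : R, 0 < x -> a <= t <= b ->
    `|g x t| <= C * expR (- (gamma ^+ 2 / 2) * x).

(** Since [poleD] adds the orders, both the second derivative in time and the
    derivative in space come out with order exactly [3]. *)
Let core_dominated n f g : (n <= 3)%N -> pole_order n f ->
  (forall x t, g x t = ig_core delta gamma x t * f x t) -> exp_dominated g.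
Proof.
move=> n3 [K K0 fK] gE.
have [C C0 HC] := ig_core_bound delta_gt0 gamma_gt0 b a_gt0.
exists (K * C) => [|x t x0 tab]; first exact: mulr_ge0.
rewrite gE normrM (ger0_norm (ig_core_ge0 _ delta_gt0 _ _)).
have c0 := ig_core_ge0 gamma delta_gt0 x t.
apply: (@le_trans _ _ (K * (ig_core delta gamma x t * (1 + x^-1) ^+ 3))).
  rewrite mulrCA ler_wpM2l//; apply: le_trans (fK _ _ x0 tab) _.
  by rewrite ler_wpM2l// ler_weXn2l// lerDl invr_ge0 ltW.
by rewrite -mulrA ler_wpM2l// HC.
Qed.

Lemma ig_density_dominated : exp_dominated (ig_density delta gamma).
Proof. by apply: (core_dominated _ pole_time) => // x t; rewrite ig_densityE. Qed.

(** The extra factor [x^-1] gives the vanishing of the density at [x = 0], hence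
    of the boundary term there in the integration by parts. *)
Lemma ig_density_div_dominated :
  exp_dominated (fun x t => x^-1 * ig_density delta gamma x t).
Proof.
apply: (core_dominated _ (poleM pole_time pole_inv)) => // x t.
by rewrite ig_densityE; ring.
Qed.

Let pole_dt := poleD (pole_cst 1) (poleD (poleM (pole_cst (delta * gamma)) pole_time)
  (poleM (poleM (pole_cst (- delta ^+ 2)) (poleM pole_time pole_time)) pole_inv)).

Lemma ig_density_dt_dominated : exp_dominated (ig_density_dt delta gamma).
Proof.
apply: (core_dominated _ pole_dt) => // x t.
by rewrite /ig_density_dt; ring.
Qed.

Lemma ig_density_dtt_dominated : exp_dominated (ig_density_dtt delta gamma).
Proof.
have H := poleM (poleM (pole_cst (- delta ^+ 2)) pole_time) pole_inv.
apply: (core_dominated _ (poleD (poleM (poleD (pole_cst (delta * gamma)) H) pole_dt)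
  (poleD (pole_cst (delta * gamma)) (poleM (pole_cst 2) H)))) => // x t.
by rewrite /ig_density_dtt; ring.
Qed.

Lemma ig_density_dx_dominated : exp_dominated (ig_density_dx delta gamma).
Proof.
apply: (core_dominated _ (poleM pole_time (poleD (poleD
  (poleM (poleM (pole_cst (delta ^+ 2 / 2)) (poleM pole_time pole_time)) (poleM pole_inv pole_inv))
  (poleM (pole_cst (- (3 / 2))) pole_inv)) (pole_cst (- (gamma ^+ 2 / 2)))))) => // x t.
by rewrite /ig_density_dx; move: (x^-1) => u; field.
Qed.

End Domination.

Section Continuity.
Context {R : realType}.
Variables (delta gamma : R).
Variables (x t : R).
Hypotheses (x_gt0 : 0 < x) (t_gt0 : 0 < t).

Lemma ig_density_continuous :
  {for x, continuous (fun x => ig_density delta gamma x t)}.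
Proof.
apply/differentiable_continuous/derivable1_diffP.
by have [] := is_derive_ig_density_x delta gamma t x_gt0.
Qed.

Let cst_cont (k : R) : (fun _ : R => k) y @[y --> x] --> k.
Proof. exact: cvg_cst. Qed.

Let inv_cont : y^-1 @[y --> x] --> x^-1.
Proof. by apply: cvgV => //; rewrite gt_eqF. Qed.

Let core_cont : ig_core delta gamma y t @[y --> x] --> ig_core delta gamma x t.
Proof.
have cE y : ig_core delta gamma y t = ig_density delta gamma y t * t^-1.
  by rewrite ig_densityE mulfK// gt_eqF.
under eq_fun do rewrite cE.
by rewrite cE; apply: cvgM => //; exact: ig_density_continuous.
Qed.

Lemma ig_density_dt_continuous :
  {for x, continuous (fun x => ig_density_dt delta gamma x t)}.
Proof.
apply: cvgM => //; apply: cvgB => //; exact: cvgM.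
Qed.

Lemma ig_density_dtt_continuous :
  {for x, continuous (fun x => ig_density_dtt delta gamma x t)}.
Proof.
apply: cvgM => //; apply: cvgD; last by apply: cvgB => //; exact: cvgM.
by apply: cvgM; apply: cvgB => //; exact: cvgM.
Qed.

Lemma ig_density_dx_continuous :
  {for x, continuous (fun x => ig_density_dx delta gamma x t)}.
Proof.
apply: cvgM; first exact: cvgM.
apply: cvgB => //; apply: cvgB; last exact: cvgM.
by apply: cvgM => //; apply: cvgM => //; rewrite expr2; exact: cvgM.
Qed.

End Continuity.

(** * Integration over the half-line *)

Lemma Rintegral_sum d (T : measurableType d) (R : realType)
    (m : {measure set T -> \bar R}) (D : set T) (n : nat) (a : nat -> R)
    (f : nat -> T -> R) : measurable D ->
  (forall i, m.-integrable D (EFin \o f i)) ->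
  \int[m]_(x in D) (\sum_(i < n) a i * f i x) =
  \sum_(i < n) a i * \int[m]_(x in D) f i x.
Proof.
move=> mD fi.
have fa i : m.-integrable D (EFin \o (fun x => a i * f i x)).
  by have := integrableZl mD (a i) (fi i); apply: eq_integrable => // x _; rewrite /= EFinM.
elim: n => [|n IH].
  under eq_Rintegral do rewrite big_ord0.
  by rewrite big_ord0 Rintegral_cst// mul0r.
under eq_Rintegral do rewrite big_ord_recr/=.
rewrite big_ord_recr/= RintegralD//; last first.
  have := @integrable_sum _ _ _ m D mD 'I_n (index_enum 'I_n) xpredT _ (fun i _ => fa i).
  by apply: eq_integrable => // x _; rewrite /= sumEFin.
by rewrite IH RintegralZl.
Qed.

Section HalfLine.
Context {R : realType}.
Notation mu := (@lebesgue_measure R).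
Let D : set (measurableTypeR R) := `]0, +oo[%classic.

Let mD : measurable D. Proof. exact: measurable_itv. Qed.

Let DE x : D x = (0 < x) :> Prop.
Proof. by rewrite /D/= in_itv/= andbT. Qed.

Lemma integrable_expR_decay (c : R) : 0 < c ->
  mu.-integrable D (fun x => (expR (- c * x))%:E).
Proof.
move=> c0.
have iD : mu.-integrable D (EFin \o exponential_pdf c).
  apply: integrableS (integrable_exponential_pdf c0) => //.
have := integrableZl mD c^-1 iD; apply: eq_integrable => // x; rewrite inE DE => x0.
rewrite /= exponential_pdfE ?(ltW x0)//.
by rewrite -EFinM mulrA mulVf ?mul1r// gt_eqF.
Qed.

Lemma integrable_exp_bounded (f : R -> R) (c C : R) : 0 < c ->
  measurable_fun D f -> (forall x : R, 0 < x -> `|f x| <= C * expR (- c * x)) ->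
  mu.-integrable D (EFin \o f).
Proof.
move=> c0 mf fC.
have := integrableZl mD C (integrable_expR_decay c0).
apply: le_integrable => //; first exact/measurable_EFinP.
move=> x; rewrite DE => x0; rewrite /= lee_fin.
by apply: le_trans (fC _ x0) _; exact: ler_norm.
Qed.

(** Integrate over [[1 / (m + 2), m + 2]]: the integral is a difference of two
    boundary values of [W], each [O(1 / m)], and converges by domination to the
    integral over the half-line. *)
Lemma Rintegral_derivative_eq0 (W w : R -> R) (c C : R) : 0 < c ->
  (forall x : R, 0 < x -> is_derive x 1 W (w x)) ->
  (forall x : R, 0 < x -> {for x, continuous w}) ->
  (forall x : R, 0 < x -> `|w x| <= C * expR (- c * x)) ->
  (forall x : R, 0 < x -> `|W x| <= C * x) ->
  (forall x : R, 0 < x -> `|W x| <= C / x) ->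
  \int[mu]_(x in D) w x = 0.
Proof.
move=> c0 dW cw wC W0 Woo.
have mw : measurable_fun D w.
  apply: open_continuous_measurable_fun; first exact: interval_open.
  by move=> x; rewrite inE DE => /cw.
have iw := integrable_exp_bounded c0 mw wC.
pose J (m : nat) : set R := `[m.+2%:R^-1, m.+2%:R]%classic.
have JD m : J m `<=` D.
  move=> x; rewrite DE /J/= in_itv/= => /andP[+ _]; apply: lt_le_trans.
  by rewrite invr_gt0.
have FTC m : (\int[mu]_(x in J m) (w x)%:E = (W m.+2%:R)%:E - (W m.+2%:R^-1)%:E)%E.
  apply: continuous_FTC2.
  - by rewrite (@lt_trans _ _ 1)// ?invf_lt1 ?ltr1n.
  - apply: continuous_in_subspaceT => x; rewrite inE => /JD; rewrite DE => /cw.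
    exact.
  - have cW x : 0 < x -> {for x, continuous W}.
      move=> x0; apply/differentiable_continuous/derivable1_diffP.
      by have [] := dW x x0.
    split.
    + move=> x; rewrite in_itv/= => /andP[mx _].
      by have [] := dW x (lt_trans _ mx) => //; rewrite invr_gt0.
    + by apply: cvg_at_right_filter; apply: cW; rewrite invr_gt0.
    + by apply: cvg_at_left_filter; apply: cW.
  - move=> x; rewrite in_itv/= => /andP[mx _]; rewrite derive1E.
    by have [] := dW x (lt_trans _ mx) => //; rewrite invr_gt0.
have L1 : (\int[mu]_(x in J m) (w x)%:E)%E @[m --> \oo] --> (\int[mu]_(x in D) (w x)%:E)%E.
  have -> : (fun m => \int[mu]_(x in J m) (w x)%:E)%E =
      (fun m => \int[mu]_(x in D) (((EFin \o w) \_ (J m)) x))%E.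
    apply/funext => m; rewrite -integral_mkcondr; congr (integral _ _ _).
    by rewrite setIidr.
  have iC : mu.-integrable D (fun x => (C * expR (- c * x))%:E).
    have := integrableZl mD C (integrable_expR_decay c0).
    by apply: eq_integrable => // x _; rewrite EFinM.
  apply: (@dominated_cvg _ _ _ mu D mD _ _ (fun x => (C * expR (- c * x))%:E)) => //.
  - move=> n; apply/(@measurable_restrict _ _ _ _ (J n) D) => //.
      exact: measurable_itv.
    apply/measurable_EFinP; apply: measurable_funS mw => //.
  - move=> x; rewrite DE => x0; apply: cvg_near_cst; near=> m.
    rewrite patchE ifT// inE /J/= in_itv/=; apply/andP; split.
    + rewrite invf_ple ?posrE//; apply: ltW.
      rewrite (@lt_le_trans _ _ m%:R)// ?ler_nat//; last by rewrite -addn2 leq_addr.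
      by near: m; exact: nbhs_infty_gtr.
    + rewrite (@le_trans _ _ m%:R)// ?ler_nat//; last by rewrite -addn2 leq_addr.
      by near: m; exact: nbhs_infty_ger.
  - move=> m x; rewrite DE => x0; rewrite patchE; case: ifP => _/=.
      by rewrite lee_fin wC.
    by rewrite normr0 lee_fin (le_trans _ (wC _ x0)).
have L2 : (\int[mu]_(x in J m) (w x)%:E)%E @[m --> \oo] --> 0%E.
  under eq_fun do rewrite FTC -EFinB.
  apply: cvg_EFin; first exact: nearW.
  have B m : `|W m.+2%:R - W m.+2%:R^-1| <= (2 * C) * m.+1%:R^-1.
    have m2 : 0 < m.+2%:R :> R by [].
    have H1 := Woo _ m2.
    have m2' : 0 < m.+2%:R^-1 :> R by rewrite invr_gt0.
    have H2 := W0 _ m2'.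
    have C0 : 0 <= C.
      by move: H2 => /(le_trans (normr_ge0 _)); rewrite pmulr_lge0.
    apply: le_trans (ler_normB _ _) _.
    apply: (@le_trans _ _ (2 * C * m.+2%:R^-1)); first by rewrite -mulrA mulr_natl mulr2n lerD.
    by rewrite ler_wpM2l ?mulr_ge0// lef_pV2 ?posrE// ler_nat.
  have S : (2 * C) * m.+1%:R^-1 @[m --> \oo] --> (0 : R).
    rewrite -(mulr0 (2 * C)); apply: cvgM; first exact: cvg_cst.
    exact: cvg_harmonic.
  apply: norm_cvg0; apply: (@squeeze_cvgr _ _ _ _ (cst 0) _ _ _ _ _ S).
    by apply: nearW => m; rewrite /= B normr_ge0.
  exact: cvg_cst.
rewrite /Rintegral.
by rewrite -(cvg_lim _ L1)// (cvg_lim _ L2).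
Unshelve. all: by end_near. Qed.

End HalfLine.

Section IntegralsAgainstDensity.
Context {R : realType}.
Notation mu := (@lebesgue_measure R).
Let D : set (measurableTypeR R) := `]0, +oo[%classic.

Let mD : measurable D. Proof. exact: measurable_itv. Qed.

Let DE x : D x = (0 < x) :> Prop.
Proof. by rewrite /D/= in_itv/= andbT. Qed.

Variables (delta gamma : R).
Hypotheses (delta_gt0 : 0 < delta) (gamma_gt0 : 0 < gamma).

Let c := gamma ^+ 2 / 2.
Let c_gt0 : 0 < c. Proof. by rewrite /c divr_gt0// exprn_gt0. Qed.

Let measurable_pos (f : R -> R) :
  (forall x : R, 0 < x -> {for x, continuous f}) -> measurable_fun D f.
Proof.
move=> cf; apply: open_continuous_measurable_fun; first exact: interval_open.
by move=> x; rewrite inE DE => /cf.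
Qed.

Lemma integrable_weighted (v : R -> R) (f : R -> R -> R) (t K : R) : 0 < t ->
  0 <= K ->
  measurable_fun D v -> (forall x : R, 0 < x -> `|v x| <= K) ->
  (forall x : R, 0 < x -> {for x, continuous (f ^~ t)}) ->
  (forall a b : R, 0 < a -> exp_dominated gamma a b f) ->
  mu.-integrable D (fun x => (v x * f x t)%:E).
Proof.
move=> t0 K0 mv vK cf /(_ t t t0)[C C0 fC].
apply: (@integrable_exp_bounded _ _ c (K * C)) => //.
  by apply: measurable_funM => //; exact: measurable_pos.
move=> x x0; rewrite normrM -mulrA ler_pM ?vK//.
by rewrite fC ?lexx.
Qed.

(** Differentiation under the integral sign, on the time window [(t / 2, 2 * t)]:
    it must stay away from time [0], where no uniform domination holds. *)
Lemma is_derive_weighted_integral (v : R -> R) (f g : R -> R -> R) (t : R) : 0 < t ->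
  measurable_fun D v -> (forall x : R, 0 < x -> `|v x| <= 1) ->
  (forall x s : R, 0 < x -> 0 < s -> {for x, continuous (f ^~ s)}) ->
  (forall x s : R, 0 < x -> 0 < s -> is_derive s 1 (f x) (g x s)) ->
  (forall a b : R, 0 < a -> exp_dominated gamma a b f) ->
  (forall a b : R, 0 < a -> exp_dominated gamma a b g) ->
  is_derive t 1 (fun s => \int[mu]_(x in D) (v x * f x s))
    (\int[mu]_(x in D) (v x * g x t)).
Proof.
move=> t0 mv v1 cf dfg bf bg.
have t20 : 0 < t / 2 by rewrite divr_gt0.
have It : `]t / 2, t * 2[%classic t.
  by rewrite /= in_itv/=; apply/andP; split; lra.
have I0 s : `]t / 2, t * 2[%classic s -> 0 < s.
  by rewrite /= in_itv/= => /andP[+ _]; exact: lt_trans.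
have [C C0 gC] := bg _ (t * 2) t20.
pose F (s x : R) := v x * f x s.
have dF (s x : R) : `]t / 2, t * 2[%classic s -> 0 < x ->
    is_derive s 1 (F ^~ x) (v x * g x s).
  move=> /I0 s0 x0.
  apply: (is_derive_eq (is_deriveZ (v x) (dfg x s x0 s0))).
  by rewrite /GRing.scale.
have F1 (s x : R) : `]t / 2, t * 2[%classic s -> 0 < x -> partial1of2 F s x = v x * g x s.
  by move=> Is x0; rewrite partial1of2E; have [] := dF s x Is x0.
have intF (s : R) : `]t / 2, t * 2[%classic s -> mu.-integrable D (EFin \o F s).
  move=> /I0 s0; apply: (@integrable_weighted v f s 1) => //.
  by move=> x x0; exact: cf.
have derF (s : R) (x : measurableTypeR R) : `]t / 2, t * 2[%classic s -> D x ->
    derivable (F ^~ x) s 1.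
  by move=> Is; rewrite DE => x0; have [] := dF s x Is x0.
pose G (x : measurableTypeR R) := C * expR (- c * x).
have G0 x : 0 <= G x by rewrite mulr_ge0 ?expR_ge0.
have iG : mu.-integrable D (EFin \o G).
  have := integrableZl mD C (integrable_expR_decay c_gt0).
  by apply: eq_integrable => // x _; rewrite EFinM.
have ubG (s : R) (x : measurableTypeR R) : `]t / 2, t * 2[%classic s -> D x ->
    `|partial1of2 F s x| <= G x.
  move=> Is; rewrite DE => x0; rewrite F1// normrM.
  rewrite -[leRHS]mul1r ler_pM ?v1// gC//.
  by move: Is; rewrite /= in_itv/= => /andP[/ltW -> /ltW ->].
apply: DeriveDef.
  exact: (derivable_under_integral mD It intF derF G0 iG ubG).
rewrite -derive1E.
rewrite (differentiation_under_integral mD It intF derF G0 iG ubG).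
by apply: eq_Rintegral => x; rewrite inE DE => x0; exact: F1.
Qed.

(** The derivative of the product [v x * ig_density delta gamma x t] integrates to
    [0], since the density vanishes at both ends of the half-line. *)
Lemma ig_density_by_parts (v v' : R -> R) (t K : R) : 0 < t -> 0 <= K ->
  (forall x : R, 0 < x -> is_derive x 1 v (v' x)) ->
  (forall x : R, 0 < x -> {for x, continuous v'}) ->
  (forall x : R, 0 < x -> `|v x| <= 1) ->
  (forall x : R, 0 < x -> `|v' x| <= K) ->
  \int[mu]_(x in D) (v x * ig_density_dx delta gamma x t) =
  - \int[mu]_(x in D) (v' x * ig_density delta gamma x t).
Proof.
move=> t0 K0 dv cv' v1 v'K.
have cv (x : R) : 0 < x -> {for x, continuous v}.
  move=> x0; apply/differentiable_continuous/derivable1_diffP.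
  by have [] := dv x x0.
have [C C0 qC] := ig_density_dominated t delta_gt0 gamma_gt0 t0.
have [C1 C10 q1C] := ig_density_div_dominated t delta_gt0 gamma_gt0 t0.
have [C2 C20 q2C] := ig_density_dx_dominated t delta_gt0 gamma_gt0 t0.
have tt : t <= t <= t by rewrite lexx.
have i1 : mu.-integrable D (EFin \o (fun x => v x * ig_density_dx delta gamma x t)).
  apply: (@integrable_weighted v _ t 1) => //; first exact: measurable_pos.
    by move=> x x0; exact: ig_density_dx_continuous.
  by move=> a b a0; exact: ig_density_dx_dominated.
have i2 : mu.-integrable D (EFin \o (fun x => v' x * ig_density delta gamma x t)).
  apply: (@integrable_weighted v' _ t K) => //; first exact: measurable_pos.
    by move=> x x0; exact: ig_density_continuous.
  by move=> a b a0; exact: ig_density_dominated.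
apply/eqP; rewrite -addr_eq0 -RintegralD//; apply/eqP.
pose W x := v x * ig_density delta gamma x t.
have Cc0 : 0 <= C / c by rewrite divr_ge0// ltW.
have KC0 : 0 <= K * C by exact: mulr_ge0.
(* One constant has to serve for the three bounds: the decay of the derivative,
   the bound C1 * x near 0 and the bound C / c * x^-1 near infinity. *)
apply: (@Rintegral_derivative_eq0 _ W _ c (C1 + C / c + (C2 + K * C))) => //.
- move=> x x0; have := is_deriveM (dv x x0) (is_derive_ig_density_x delta gamma t x0).
  by move=> H; apply: (is_derive_eq H); rewrite /GRing.scale/= [X in _ + X]mulrC.
- move=> x x0; apply: cvgD; apply: cvgM.
  + exact: cv.
  + exact: ig_density_dx_continuous.
  + exact: cv'.
  + exact: ig_density_continuous.
- move=> x x0; apply: le_trans (ler_normD _ _) _.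
  have H1 : `|v x * ig_density_dx delta gamma x t| <= C2 * expR (- c * x).
    by rewrite normrM -[leRHS]mul1r ler_pM ?v1 ?q2C.
  have H2 : `|v' x * ig_density delta gamma x t| <= K * C * expR (- c * x).
    by rewrite normrM -mulrA ler_pM ?v'K ?qC.
  apply: le_trans (lerD H1 H2) _; rewrite -mulrDl ler_wpM2r ?expR_ge0//; lra.
- move=> x x0; rewrite normrM -[leRHS]mul1r ler_pM ?v1//.
  have e1 : expR (- c * x) <= 1 by rewrite expR_le1 mulNr oppr_le0 mulr_ge0// ltW.
  have := q1C x t x0 tt; rewrite normrM gtr0_norm ?invr_gt0//.
  rewrite mulrC ler_pdivrMr// => /le_trans; apply; rewrite ler_wpM2r ?(ltW x0)//.
  apply: (@le_trans _ _ C1); first by rewrite ler_piMr.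
  by lra.
- move=> x x0; rewrite normrM -[leRHS]mul1r ler_pM ?v1//.
  apply: le_trans (qC x t x0 tt) _.
  (* c * x <= expR (c * x) *)
  have e1 : expR (- c * x) <= c^-1 / x.
    rewrite mulNr expRN -invfM lef_pV2 ?posrE ?expR_gt0 ?mulr_gt0//.
    by apply: le_trans (expR_ge1Dx _); rewrite lerDr.
  apply: (@le_trans _ _ (C / c / x)); first by rewrite -mulrA ler_wpM2l.
  by rewrite ler_wpM2r ?invr_ge0 ?(ltW x0)//; lra.
Qed.

End IntegralsAgainstDensity.

(** * Evaluation of a counting process at an independent random time *)

Section Grid.
Context {R : realType}.

Definition cell (m i : nat) : set R := `[i%:R / m.+1%:R, i.+1%:R / m.+1%:R[%classic.

(** The right end of the cell of [x]: it lies strictly above [x], so that right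
    continuity at [x] applies along the grids. *)
Definition grid (m : nat) (x : R) : R := (Num.truncn (x * m.+1%:R)).+1%:R / m.+1%:R.

Lemma cellP (m i : nat) (x : R) : 0 <= x ->
  cell m i x <-> Num.truncn (x * m.+1%:R) = i.
Proof.
move=> x0; have xm0 : 0 <= x * m.+1%:R by rewrite mulr_ge0.
rewrite /cell/= in_itv/= ler_pdivrMr// ltr_pdivlMr//; split.
  exact: truncn_def.
by move=> <-; exact: truncn_itv.
Qed.

Lemma cell_ge0 (m i : nat) (x : R) : cell m i x -> 0 <= x.
Proof. by rewrite /cell/= in_itv/= => /andP[+ _]; apply: le_trans; rewrite divr_ge0. Qed.

Lemma grid_cell (m i : nat) (x : R) : cell m i x -> grid m x = i.+1%:R / m.+1%:R.
Proof. by move=> cx; rewrite /grid ((cellP m i (cell_ge0 cx)).1 cx). Qed.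

Lemma measurable_cell (m i : nat) : measurable (cell m i).
Proof. exact: measurable_itv. Qed.

Lemma trivIset_cell (m : nat) : trivIset setT (cell m).
Proof.
apply/trivIsetP => i j _ _ ij; apply/seteqP; split => // x [ci cj].
have x0 := cell_ge0 ci; move: ij.
by rewrite -((cellP m i x0).1 ci) -((cellP m j x0).1 cj) eqxx.
Qed.

Lemma grid_gt (m : nat) (x : R) : 0 <= x -> x < grid m x.
Proof.
move=> x0; have xm0 : 0 <= x * m.+1%:R by rewrite mulr_ge0.
by rewrite /grid ltr_pdivlMr//; have /andP[] := truncn_itv xm0.
Qed.

Lemma grid_le (m : nat) (x : R) : 0 <= x -> grid m x <= x + m.+1%:R^-1.
Proof.
move=> x0; have xm0 : 0 <= x * m.+1%:R by rewrite mulr_ge0.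
rewrite /grid ler_pdivrMr// mulrDl mulVf ?pnatr_eq0// -natr1 lerD2r.
by have /andP[] := truncn_itv xm0.
Qed.

Lemma cvg_grid (f : R -> R) (x l : R) : 0 <= x ->
  f s @[s --> x^'+] --> l -> f (grid m x) @[m --> \oo] --> l.
Proof.
move=> x0 /cvg_at_rightP; apply; split; first by move=> m; exact: grid_gt.
apply: (@squeeze_cvgr _ _ _ _ (cst x) (fun m => x + m.+1%:R^-1)).
- by apply: nearW => m /=; rewrite (ltW (grid_gt m x0)) grid_le.
- exact: cvg_cst.
- rewrite -[X in _ --> X]addr0; apply: cvgD; first exact: cvg_cst.
  exact: cvg_harmonic.
Qed.

End Grid.

Section TimeChange.
Context (R : realType) (d : measure_display) (T : measurableType d).
Variables (P : probability T R) (M : R -> T -> nat) (V : T -> R) (q : R -> R) (n : nat).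
Notation mu := (@lebesgue_measure R).
Let D : set (measurableTypeR R) := `]0, +oo[%classic.
Let pmf (x : R) := count_pmf P M n x.

Hypothesis measurable_M : forall x : R, 0 <= x -> measurable [set w | M x w = n].
Hypothesis M_right_continuous : forall w (x : R), 0 <= x ->
  ((M s w)%:R : R) @[s --> x^'+] --> ((M x w)%:R : R).
Hypothesis V_ge0 : forall w, 0 <= V w.
Hypothesis measurable_V : measurable_fun setT V.
Hypothesis V_density : forall B : set R, measurable B ->
  P (V @^-1` B) = (\int[mu]_(x in B `&` D) (q x)%:E)%E.
Hypothesis q_ge0 : forall x : R, 0 < x -> 0 <= q x.
Hypothesis integrable_q : mu.-integrable D (EFin \o q).
Hypothesis independent_MV : forall (x : R) (B : set R), 0 <= x -> measurable B ->
  prob P ([set w | M x w = n] `&` V @^-1` B) = pmf x * prob P (V @^-1` B).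
Hypothesis pmf_continuous : forall x : R, 0 < x -> {for x, continuous pmf}.

Let mD : measurable D. Proof. exact: measurable_itv. Qed.

Let DE x : D x = (0 < x) :> Prop.
Proof. by rewrite /D/= in_itv/= andbT. Qed.

Let pmf_le1 (x : R) : 0 <= x -> `|pmf x| <= 1.
Proof.
move=> x0; rewrite ger0_norm ?count_pmf_ge0//.
by apply: prob_le1; exact: measurable_M.
Qed.

Let gridV (m : nat) : set T := [set w | M (grid m (V w)) w = n].

Let node_ge0 m i : 0 <= i.+1%:R / m.+1%:R :> R.
Proof. exact: divr_ge0. Qed.

Let piece (m i : nat) : set T :=
  [set w | M (i.+1%:R / m.+1%:R) w = n] `&` V @^-1` (cell m i).

Let gridVE m : gridV m = \bigcup_i piece m i.
Proof.
apply/seteqP; split => w /=.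
- move=> Mw; exists (Num.truncn (V w * m.+1%:R)) => //.
  have c : cell m (Num.truncn (V w * m.+1%:R)) (V w) by exact/cellP.
  by split => //=; rewrite -(grid_cell c).
- by move=> [i _ [/= Mi ci]]; rewrite /gridV/= (grid_cell ci).
Qed.

Let measurable_preV (B : set R) : measurable B -> measurable (V @^-1` B).
Proof. by move=> mB; rewrite -[X in measurable X]setTI; exact: measurable_V. Qed.

Let measurable_piece m i : measurable (piece m i).
Proof.
apply: measurableI; first exact: measurable_M.
by apply: measurable_preV; exact: measurable_cell.
Qed.

Let measurable_gridV m : measurable (gridV m).
Proof. by rewrite gridVE; exact: bigcupT_measurable. Qed.

Let trivIset_cellD m : trivIset setT (fun i => cell m i `&` D).
Proof.
apply/trivIsetP => i j _ _ ij; have /trivIsetP/(_ i j I I ij) := @trivIset_cell R m.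
by rewrite setIACA => ->; rewrite set0I.
Qed.

Let cellD m : D = \bigcup_i (cell m i `&` D).
Proof.
apply/seteqP; split => x; last by move=> [i _ []].
move=> Dx; exists (Num.truncn (x * m.+1%:R)) => //; split => //.
have x0 : (0 : R) <= x by move: Dx; rewrite DE => /ltW.
by apply/(cellP m _ x0).
Qed.

Let measurable_cellD m i : measurable (cell m i `&` D : set (measurableTypeR R)).
Proof. by apply: measurableI => //; exact: measurable_cell. Qed.

Let measurable_q : measurable_fun D q.
Proof. by have /integrableP[/measurable_EFinP] := integrable_q. Qed.

Let measurable_pmf_grid m : measurable_fun D (fun x => pmf (grid m x) * q x).
Proof.
apply: measurable_funM => //; rewrite (cellD m).
apply/measurable_fun_bigcup => //= i.
apply: (@eq_measurable_fun _ _ _ _ _ (cst (pmf (i.+1%:R / m.+1%:R)))).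
  by move=> x; rewrite inE => -[/grid_cell -> _].
exact: measurable_cst.
Qed.

(** On each cell the process is evaluated at a deterministic time, so that
    independence applies cell by cell. *)
Let prob_gridV m : P (gridV m) = (\int[mu]_(x in D) (pmf (grid m x) * q x)%:E)%E.
Proof.
rewrite gridVE measure_bigcup//=; last first.
  apply/trivIsetP => i j _ _ ij; apply/seteqP; split => // w [[_ ci] [_ cj]].
  have /trivIsetP/(_ i j I I ij) := @trivIset_cell R m.
  by move=> /seteqP[/(_ (V w))] + _; apply.
rewrite [in RHS](cellD m) ge0_integral_bigcup//; last 2 first.
- by rewrite -(cellD m); exact/measurable_EFinP.
- move=> x; rewrite -(cellD m) DE => x0; rewrite lee_fin mulr_ge0 ?q_ge0//.
  exact: count_pmf_ge0.
rewrite (@eq_eseriesl _ _ xpredT); last by move=> i; rewrite in_setT.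
apply: eq_eseriesr => i _.
have mc := @measurable_cell R m i.
rewrite -probE// independent_MV// EFinM (probE P (measurable_preV mc)).
rewrite V_density// -integralZl//; last first.
  by apply: integrableS integrable_q => //; exact: subIsetr.
apply: eq_integral => x; rewrite inE => -[/grid_cell -> _].
by rewrite EFinM.
Qed.

Let cvg_indic w :
  (\1_(gridV m) w : R) @[m --> \oo] --> (\1_[set w | M (V w) w = n] w : R).
Proof.
have H := cvg_grid (V_ge0 w) (M_right_continuous (w := w) (V_ge0 w)).
apply: cvg_near_cst.
have /cvgrPdist_lt/(_ 1 ltr01) := H.
apply: filterS => m; rewrite ltr_norml => /andP[lt1 lt2].
(* Two natural numbers at distance less than 1 are equal. *)
have E : M (grid m (V w)) w = M (V w) w.
  apply/eqP; rewrite eqn_leq -ltnS -[X in _ && X]ltnS -!(ltr_nat R) -!natr1.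
  by apply/andP; split; lra.
suff W : (w \in gridV m) = (w \in [set w | M (V w) w = n]) by rewrite !indicE W.
by apply/idP/idP; rewrite !inE /gridV/= E.
Qed.

(** Evaluating [M] at the grid point above [V] instead of [V] makes the formula a
    countable sum of products.  Both sides pass to the limit by domination: on
    the left the indicators converge since the paths are right continuous, on
    the right the probabilities converge since they are continuous in time. *)
Lemma time_changed_prob :
  measurable [set w | M (V w) w = n] /\
  prob P [set w | M (V w) w = n] = \int[mu]_(x in D) (pmf x * q x).
Proof.
have mA : measurable [set w | M (V w) w = n].
  have : measurable_fun setT (\1_[set w | M (V w) w = n] : T -> R).
    apply: (measurable_fun_cvg (h := fun m => \1_(gridV m))) => //.
  exact: (measurable_indicP R _).2.
split => //; apply: EFin_inj; rewrite probE//.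
have L1 : (P (gridV m) @[m --> \oo] --> P [set w | M (V w) w = n])%E.
  have indicE' A : measurable A -> P A = (\int[P]_w (\1_A w)%:E)%E.
    by move=> mB; rewrite integral_indic// setIT.
  rewrite indicE'//; under eq_fun do rewrite indicE'//.
  apply: (@dominated_cvg _ _ _ P setT measurableT _ _ (cst 1%E)) => //.
  - by move=> m; apply/measurable_EFinP; exact: measurable_indic.
  - by move=> w _; apply: cvg_EFin; [exact: nearW|exact: cvg_indic].
  - by apply: finite_measure_integrable_cst.
  - by move=> m w _; rewrite lee_fin ger0_norm ?indic_le1.
have iT : mu.-integrable D (EFin \o (fun x => pmf x * q x)).
  have mpi : measurable_fun D pmf.
    apply: open_continuous_measurable_fun; first exact: interval_open.
    by move=> x; rewrite inE DE => /pmf_continuous.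
  apply: le_integrable integrable_q => //.
    by apply/measurable_EFinP; exact: measurable_funM.
  move=> x; rewrite DE => x0; rewrite /= lee_fin normrM ler_piMl//.
  exact/pmf_le1/ltW.
have L2 : ((\int[mu]_(x in D) (pmf (grid m x) * q x)%:E) @[m --> \oo] -->
    \int[mu]_(x in D) (pmf x * q x)%:E)%E.
  apply: (@dominated_cvg _ _ _ mu D mD _ _ (EFin \o q)) => //.
  - by move=> m; apply/measurable_EFinP.
  - move=> x; rewrite DE => x0; apply: cvg_EFin; first exact: nearW.
    apply: cvgM; last exact: cvg_cst.
    apply: (cvg_grid (ltW x0)); apply: cvg_at_right_filter; exact: pmf_continuous.
  - move=> m x; rewrite DE => x0; rewrite lee_fin normrM (ger0_norm (q_ge0 x0)).
    rewrite ler_piMl ?q_ge0//.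
    exact/pmf_le1/ltW/(lt_le_trans x0)/ltW/grid_gt/ltW.
rewrite /Rintegral fineK; last exact: integrable_fin_num.
rewrite -(cvg_lim _ L1)// -(cvg_lim _ L2)//.
by under eq_fun do rewrite prob_gridV.
Qed.

End TimeChange.

(** * The governing equation of the time-changed process *)

Theorem proposition4p7 (R : realType) (d : measure_display)
    (T : measurableType d) (P : probability T R)
    (k : nat) (lam : nat -> R) (delta gamma : R)
    (M : R -> T -> nat) (Y : R -> T -> R)
    (k_ge1 : (1 <= k)%N)
    (lam_gt0 : forall j : nat, (1 <= j <= k)%N -> 0 < lam j)
    (delta_gt0 : 0 < delta) (gamma_gt0 : 0 < gamma)
    (igsY : inverse_gaussian_subordinator P delta gamma Y)
    (gcpM : generalized_counting_process P k lam M)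
    (indMY : independent_processes P (fun t w => (M t w)%:R) Y) :
  let Lambda := \sum_(1 <= j < k.+1) lam j in
  let p := time_changed_pmf P M Y in
  forall (n : nat) (t : R), 0 < t ->
    [/\ derivable (p n) t 1,
        derivable (derive1 (p n)) t 1 &
        derive1n 2 (p n) t - 2 * delta * gamma * derive1 (p n) t =
        2 * delta ^+ 2 *
          (Lambda * p n t
           - \sum_(1 <= j < (minn n k).+1) lam j * p (n - j)%N t)].
Proof.
move=> Lambda p n t t0.
pose mu : {measure set (measurableTypeR R) -> \bar R} := lebesgue_measure.
pose D : set (measurableTypeR R) := `]0, +oo[%classic.
have mD : measurable D by exact: measurable_itv.
have DE x : D x = (0 < x) :> Prop by rewrite /D/= in_itv/= andbT.
have subM := gcp_subordinator gcpM.
have subY := igs_subordinator igsY.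
pose u := count_pmf P M.
have du m (x : R) : 0 < x -> is_derive x 1 (u m)
    (\sum_(i < m.+1) jump_rate k lam i * u (m - i)%N x).
  exact: is_derive_count_pmf.
have cu m (x : R) : 0 < x -> {for x, continuous (u m)}.
  move=> x0; apply/differentiable_continuous/derivable1_diffP.
  by have [] := du m x x0.
have u1 m (x : R) : 0 < x -> `|u m x| <= 1.
  by move=> x0; apply: (count_pmf_norm_le1 gcpM); exact: ltW.
have mu_ m : measurable_fun D (u m).
  apply: open_continuous_measurable_fun; first exact: interval_open.
  by move=> x; rewrite inE DE; exact: cu.
pose F m (f : R -> R -> R) (s : R) := \int[mu]_(x in D) (u m x * f x s).
pose q := ig_density delta gamma.
have integr m (f : R -> R -> R) (s : R) : 0 < s ->
    (forall x : R, 0 < x -> {for x, continuous (f ^~ s)}) ->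
    (forall a b : R, 0 < a -> exp_dominated gamma a b f) ->
    mu.-integrable D (EFin \o (fun x => u m x * f x s)).
  by move=> s0; apply: (@integrable_weighted _ gamma gamma_gt0 _ _ _ 1) => //; exact: u1.
have iq m (s : R) : 0 < s -> mu.-integrable D (EFin \o (fun x => u m x * q x s)).
  move=> s0; apply: integr => //.
    by move=> x x0; exact: ig_density_continuous.
  by move=> a b a0; exact: ig_density_dominated.
have pF m (s : R) : 0 < s -> p m s = F m q s.
  move=> s0.
  have Y0 w : 0 <= Y s w.
    have := subordinator_nondecreasing subY w (lexx 0) (ltW s0).
    by rewrite (subordinator_start subY w).
  have mY := subordinator_measurable subY (ltW s0).
  apply: (proj2 (@time_changed_prob _ _ _ P M (Y s) (q ^~ s) m _ _ Y0 mY _ _ _ _ _)).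
  - by move=> x; exact: (measurable_count_eq gcpM).
  - by move=> w x x0; exact: (subordinator_right_continuous subM).
  - by move=> B mB; rewrite (igs_density igsY)// set_itvoy.
  - move=> x x0; rewrite /q ig_densityE mulr_ge0 ?(ltW s0)//.
    exact: ig_core_ge0.
  - have [C C0 qC] := ig_density_dominated s delta_gt0 gamma_gt0 s0.
    apply: (@integrable_exp_bounded _ _ (gamma ^+ 2 / 2) C).
    + by rewrite divr_gt0// exprn_gt0.
    + apply: open_continuous_measurable_fun; first exact: interval_open.
      move=> x; rewrite inE/= in_itv/= andbT => x0.
      exact: ig_density_continuous.
    + by move=> x x0; rewrite qC// lexx.
  - move=> x B x0 mB; apply: indMY; apply: sub_sigma_algebra.
      exists x, [set m%:R]; split => //.
      by apply/seteqP; split => w /= => [->//|/eqP]; rewrite eqr_nat => /eqP.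
    by exists s, B; split => //; exact: ltW.
  - by move=> x; exact: cu.
have dp (s : R) : 0 < s -> is_derive s 1 (p n) (F n (ig_density_dt delta gamma) s).
  move=> s0.
  apply: (near_eq_is_derive (f := F n q)).
    by near=> r; rewrite pF//; near: r; exact: lt_nbhsr.
  apply: (@is_derive_weighted_integral _ gamma) => //.
  - exact: u1.
  - by move=> x r x0 r0; exact: ig_density_continuous.
  - by move=> x r x0 r0; exact: is_derive_ig_density_t.
  - by move=> a b a0; exact: ig_density_dominated.
  - by move=> a b a0; exact: ig_density_dt_dominated.
have dpE (s : R) : 0 < s -> derive1 (p n) s = F n (ig_density_dt delta gamma) s.
  by move=> s0; rewrite derive1E; have [] := dp s s0.
have ddp : is_derive t 1 (derive1 (p n)) (F n (ig_density_dtt delta gamma) t).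
  apply: (near_eq_is_derive (f := F n (ig_density_dt delta gamma))).
    by near=> r; rewrite dpE//; near: r; exact: lt_nbhsr.
  apply: (@is_derive_weighted_integral _ gamma) => //.
  - exact: u1.
  - by move=> x r x0 r0; exact: ig_density_dt_continuous.
  - by move=> x r x0 r0; exact: is_derive_ig_density_dt.
  - by move=> a b a0; exact: ig_density_dt_dominated.
  - by move=> a b a0; exact: ig_density_dtt_dominated.
split; first by have [] := dp t t0.
  by have [] := ddp.
rewrite derive1Sn derive1n1 derive1E (dpE t t0).
have -> : 'D_1 (derive1 (p n)) t = F n (ig_density_dtt delta gamma) t by have [] := ddp.
have idtt : mu.-integrable D (EFin \o (fun x => u n x * ig_density_dtt delta gamma x t)).
  apply: integr => //.
    by move=> x x0; exact: ig_density_dtt_continuous.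
  by move=> a b a0; exact: ig_density_dtt_dominated.
have idt : mu.-integrable D (EFin \o (fun x => u n x * ig_density_dt delta gamma x t)).
  apply: integr => //.
    by move=> x x0; exact: ig_density_dt_continuous.
  by move=> a b a0; exact: ig_density_dt_dominated.
have idx : mu.-integrable D (EFin \o (fun x => u n x * ig_density_dx delta gamma x t)).
  apply: integr => //.
    by move=> x x0; exact: ig_density_dx_continuous.
  by move=> a b a0; exact: ig_density_dx_dominated.
have pde : F n (ig_density_dtt delta gamma) t - 2 * delta * gamma * F n (ig_density_dt delta gamma) t
    = 2 * delta ^+ 2 * F n (ig_density_dx delta gamma) t.
  rewrite /F -RintegralZl// -RintegralB//; last first.
    have := integrableZl mD (2 * delta * gamma) idt.
    by apply: eq_integrable => // x _; rewrite /= EFinM.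
  rewrite -RintegralZl//; apply: eq_Rintegral => x; rewrite inE DE => x0.
  by rewrite (mulrCA (2 * delta ^+ 2)) -ig_density_pde//; ring.
(* The space derivative moves from the density to the pmf of M, whose
   derivative is given by the forward equation. *)
rewrite pde; congr (_ * _).
rewrite /F (@ig_density_by_parts _ delta gamma delta_gt0 gamma_gt0 _
  (fun x => \sum_(i < n.+1) jump_rate k lam i * u (n - i)%N x) t
  (\sum_(i < n.+1) `|jump_rate k lam i|)) //; last first.
- move=> x x0; apply: le_trans (ler_norm_sum _ _ _) _.
  by apply: ler_sum => i _; rewrite normrM ler_piMr// u1.
- exact: u1.
- move=> x x0; apply: cvg_sumr => i; apply: cvgM; first exact: cvg_cst.
  exact: cu.
- by rewrite sumr_ge0.
under eq_Rintegral => x _.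
  rewrite mulr_suml; under eq_bigr do rewrite -mulrA.
  over.
rewrite (@Rintegral_sum _ _ _ mu D n.+1 (jump_rate k lam) (fun i x => u (n - i)%N x * q x t))//; last first.
  by move=> i; exact: iq.
under eq_bigr do rewrite -[Rintegral _ _ _]/(F _ q t) -pF//.
by rewrite (jump_rate_sum k lam n (fun m => p m t)) opprK.
Unshelve. all: by end_near. Qed.
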